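(* Let $a$ be an integer. The pair $\{a,a\}$ is a Bhaskara pair if and only if $a=2n^6$ for some nonnegative integer $n$. In that case the integers $x=2n^4$ and $y=4n^9$ satisfy $a^2+a^2=x^3$ and $a^3+a^3=y^2$.
   Context: A Bhaskara pair is a pair $\{a,b\}$ of integers for which there exist integers $x,y$ with $a^2+b^2=x^3$ and $a^3+b^3=y^2$. A Bhaskara pair with $a=b$ is called a pair of Bhaskara twins. *)

(* Defs.v *)
From mathcomp Require Import all_boot all_order all_algebra.

Set Implicit Arguments.
Unset Strict Implicit.
Unset Printing Implicit Defensive.

Import Order.TTheory GRing.Theory Num.Theory.

Local Open Scope ring_scope.

(* The condition is symmetric in a and b, so the unordered pair {a, b} is
   represented by its two entries; a = b is allowed. *)
Definition bhaskara_pair (a b : int) : Prop :=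
  exists x y : int, a ^+ 2 + b ^+ 2 = x ^+ 3 /\ a ^+ 3 + b ^+ 3 = y ^+ 2.

(* Main.v *)
(* Writing a = 2 b, the equations 2 a^2 = x^3 and 2 a^3 = y^2 force x = 2 z and
   y = 4 w with b^2 = z^3 and b^3 = w^2.  Whenever a square equals a cube, it is
   the sixth power of a number e, the two bases being e^3 and e^2.  So b is both
   a cube and a square, and applying the same fact once more to b itself shows
   that b is a sixth power. *)
Require Import Defs.
From mathcomp Require Import all_boot all_order all_algebra.
From mathcomp Require Import zify ring.

Import Order.TTheory GRing.Theory Num.Theory.

Local Open Scope ring_scope.

(** For [k > 0], [k ^ 2] divides [k ^ 3 = m ^ 2], so [k] divides [m]; the quotient [e] satisfies
    [e ^ 2 * k ^ 2 = k ^ 3], and cancelling [k ^ 2] leaves [k = e ^ 2]. *)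
Lemma sqrn_eq_cube (m k : nat) :
  (m ^ 2 = k ^ 3 -> exists e, m = e ^ 3 /\ k = e ^ 2)%N.
Proof.
move=> mk; case: (posnP k) => [k0|k_gt0].
  by exists 0%N; move: mk; rewrite k0 => /eqP; rewrite expn_eq0 => /andP[/eqP].
have /dvdnP[e me] : (k %| m)%N by rewrite -(@dvdn_pexp2r _ _ 2) // mk dvdn_exp2l.
have ke : k = (e ^ 2)%N.
  apply/eqP; rewrite -(@eqn_pmul2r (k ^ 2)) ?expn_gt0 ?k_gt0 //.
  by rewrite -expnMn -me mk -expnS.
by exists e; rewrite me {1}ke.
Qed.

Lemma even_root (n k m : nat) :
  (0 < n -> k ^ n = 2 * m -> exists j, k = 2 * j)%N.
Proof.
move=> n_gt0 km; have /dvdnP[j ->] : (2 %| k)%N.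
  by have := @Euclid_dvdX k n 2 isT; rewrite km dvdn_mulr // n_gt0 andbT.
by exists j; rewrite mulnC.
Qed.

Lemma double_sqr_cube_sixth (a x y : nat) :
  (2 * a ^ 2 = x ^ 3 -> 2 * a ^ 3 = y ^ 2 -> exists n, a = 2 * n ^ 6)%N.
Proof.
move=> ax ay.
have [z xz] := @even_root 3 x _ isT (esym ax).
have [v yv] := @even_root 2 y _ isT (esym ay).
(* Halving [2 * a ^ 3 = (2 * v) ^ 2] gives [a ^ 3 = 2 * v ^ 2]; once [a = 2 * b], this becomes
   [v ^ 2 = 4 * b ^ 3]. *)
have [b ab] : exists b, a = (2 * b)%N.
  by apply: (@even_root 3 a (v ^ 2)) => //; rewrite yv in ay; nia.
have [w vw] : exists w, v = (2 * w)%N.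
  apply: (@even_root 2 v (2 * b ^ 3)) => //; rewrite yv ab !expnMn in ay; lia.
have bz : (b ^ 2 = z ^ 3)%N by rewrite xz ab !expnMn in ax; lia.
have wb : (w ^ 2 = b ^ 3)%N by rewrite yv vw ab !expnMn in ay; lia.
have [d [bd _]] := @sqrn_eq_cube _ _ bz.
have [c [_ bc]] := @sqrn_eq_cube _ _ wb.
have [|e [ce _]] := @sqrn_eq_cube c d; first by rewrite -bc.
by exists e; rewrite ab bc ce -expnM.
Qed.

Theorem theorem2p5 (a : int) :
  (bhaskara_pair a a <-> exists n : nat, a = 2 * n%:Z ^+ 6) /\
  (forall n : nat, a = 2 * n%:Z ^+ 6 ->
     a ^+ 2 + a ^+ 2 = (2 * n%:Z ^+ 4) ^+ 3 /\
     a ^+ 3 + a ^+ 3 = (4 * n%:Z ^+ 9) ^+ 2).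
Proof.
have witness (n : nat) : a = 2 * n%:Z ^+ 6 ->
    a ^+ 2 + a ^+ 2 = (2 * n%:Z ^+ 4) ^+ 3 /\
    a ^+ 3 + a ^+ 3 = (4 * n%:Z ^+ 9) ^+ 2.
  by move=> ->; split; ring.
split=> //; split=> [[x [y [ax ay]]]|[n an]]; last first.
  by exists (2 * n%:Z ^+ 4), (4 * n%:Z ^+ 9); exact: witness.
(* Twice [a ^ 3] is a square, and an odd power keeps the sign; this allows [a] to be recovered from
   its absolute value. *)
have a_ge0 : 0 <= a.
  rewrite -(exprn_odd_ge0 (n := 3)) // -(pmulrn_lge0 _ (n := 2)) //.
  by rewrite mulr2n ay sqr_ge0.
(* Absolute values are multiplicative, so both equations descend to [nat]. *)
have [||n an] := @double_sqr_cube_sixth `|a|%N `|x|%N `|y|%N.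
- by rewrite -!abszX -ax -mulr2n -mulr_natl abszM.
- by rewrite -!abszX -ay -mulr2n -mulr_natl abszM.
by exists n; rewrite -(gez0_abs a_ge0) an PoszM -rmorphXn /= natz.
Qed.
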